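(* For every $n\ge 3$, in the edge-distinguishing game (EDGe) played on the triangular book graph $B_n$ (with $\lambda(B_n)$ colors), Player 2 has a winning strategy.
   Context: $B_n=K_2\nabla\overline{K_{n-2}}$: two adjacent spine vertices plus $n-2$ pairwise nonadjacent vertices each adjacent to both spine vertices. For a positive integer $k$ let $[k]=\{1,\dots,k\}$. A $k$-coloring $c:V(G)\to[k]$ induces $c'(\{u,v\})=\{c(u),c(v)\}$ (a multiset); $c$ is edge-distinguishing if $c'$ is injective, and $\lambda(G)$ is the least $k$ admitting such a coloring. A partial coloring on $U\subseteq V(G)$ has partial induced edge coloring on $G[U]$. EDGe on $G$: two players, Player 1 first, alternately color an uncolored vertex with a color from $[\lambda(G)]$; a move is legal iff afterwards the partial induced edge coloring of the colored vertices is injective. The player making the last legal move wins. A winning strategy guarantees a win regardless of the opponent's play. *)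

(* Defs.v *)
From HB Require Import structures.
From mathcomp Require Import all_boot.

Set Implicit Arguments.
Unset Strict Implicit.
Unset Printing Implicit Defensive.

Record sgraph := SGraph {
  vertex :> finType;
  adj : rel vertex;
  adj_sym : symmetric adj;
  adj_irrefl : irreflexive adj
}.

Definition edges (G : sgraph) : {set {set G}} :=
  [set e | [exists x, exists y, adj x y && (e == [set x; y])]].

Definition complete_adj m : rel 'I_m := fun i j => i != j.

Fact complete_adj_sym m : symmetric (@complete_adj m).
Proof. by move=> i j; rewrite /complete_adj eq_sym. Qed.

Fact complete_adj_irrefl m : irreflexive (@complete_adj m).
Proof. by move=> i; rewrite /complete_adj eqxx. Qed.

Definition complete m : sgraph :=
  SGraph (@complete_adj_sym m) (@complete_adj_irrefl m).

Definition compl_adj (G : sgraph) : rel G :=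
  fun x y => (x != y) && ~~ adj x y.

Fact compl_adj_sym G : symmetric (@compl_adj G).
Proof. by move=> x y; rewrite /compl_adj eq_sym adj_sym. Qed.

Fact compl_adj_irrefl G : irreflexive (@compl_adj G).
Proof. by move=> x; rewrite /compl_adj eqxx. Qed.

Definition complement (G : sgraph) : sgraph :=
  SGraph (@compl_adj_sym G) (@compl_adj_irrefl G).

Definition join_adj (G H : sgraph) : rel (G + H)%type :=
  fun x y => match x, y with
             | inl u, inl v => adj u v
             | inr u, inr v => adj u v
             | _, _ => true
             end.

Fact join_adj_sym G H : symmetric (@join_adj G H).
Proof. by case=> u; case=> v //=; apply: adj_sym. Qed.

Fact join_adj_irrefl G H : irreflexive (@join_adj G H).
Proof. by case=> u; apply: adj_irrefl. Qed.

Definition join (G H : sgraph) : sgraph :=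
  SGraph (@join_adj_sym G H) (@join_adj_irrefl G H).

(* B_n = K_2 \nabla \overline{K_{n-2}}; n - 2 is truncated, so this has n
   vertices only when 2 <= n. *)
Definition book n : sgraph := join (complete 2) (complement (complete (n - 2))).

(* The color set [k] = {1, ..., k} is represented by 'I_k, and a multiset of
   colors by its multiplicity function. *)
Definition edge_color (V : finType) k (c : V -> 'I_k) (e : {set V}) :
    {ffun 'I_k -> nat} :=
  [ffun a => #|[set x in e | c x == a]|].

Definition edge_distinguishing (G : sgraph) k (c : G -> 'I_k) : bool :=
  dinjectiveb (edge_color c) (mem (edges G)).

Definition ed_colorable (G : sgraph) k : bool :=
  (0 < k) && [exists c : {ffun G -> 'I_k}, edge_distinguishing c].

Lemma ed_colorable_exists (G : sgraph) : exists k, ed_colorable G k.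
Proof.
exists #|G|.+1; apply/andP; split=> //; apply/existsP.
pose c (x : G) := widen_ord (leqnSn #|G|) (enum_rank x).
have c_inj : injective c.
  by move=> x y /(congr1 val) /= /val_inj /enum_rank_inj.
exists [ffun x => c x]; apply/dinjectiveP=> e f _ _ /ffunP eq_ef.
have countE (e' : {set G}) x :
    edge_color [ffun x => c x] e' (c x) = (x \in e').
  rewrite ffunE; case: (boolP (x \in e')) => xe.
    rewrite (_ : [set _ in _ | _] = [set x]) ?cards1 //.
    apply/setP=> y; rewrite !inE ffunE (inj_eq c_inj).
    by case: eqP => [->|_]; rewrite ?xe ?andbF.
  apply/eqP; rewrite cards_eq0; apply/eqP/setP=> y; rewrite !inE ffunE.
  by rewrite (inj_eq c_inj); case: eqP => [->|_]; rewrite ?andbF ?(negPf xe).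
apply/setP=> x; have := eq_ef (c x); rewrite !countE.
by case: (x \in e); case: (x \in f).
Qed.

Definition lambda (G : sgraph) : nat := ex_minn (ed_colorable_exists G).

Definition partial_coloring (G : sgraph) k := {ffun G -> option 'I_k}.

Definition colored G k (c : partial_coloring G k) : {set G} :=
  [set x | c x != None].

Definition induced_edges (G : sgraph) (U : {set G}) : {set {set G}} :=
  [set e in edges G | e \subset U].

Definition partial_edge_color G k (c : partial_coloring G k) (e : {set G}) :
    {ffun 'I_k -> nat} :=
  [ffun a => #|[set x in e | c x == Some a]|].

Definition partial_edge_distinguishing G k (c : partial_coloring G k) : bool :=
  dinjectiveb (partial_edge_color c) (mem (induced_edges (colored c))).

Inductive player := Player1 | Player2.

Definition move (G : sgraph) : Type := (G * 'I_(lambda G))%type.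

Definition position (G : sgraph) := partial_coloring G (lambda G).

Definition start (G : sgraph) : position G := [ffun=> None].

Definition apply_move G (c : position G) (m : move G) : position G :=
  [ffun x => if x == m.1 then Some m.2 else c x].

Definition legal G (c : position G) (m : move G) : bool :=
  (m.1 \notin colored c) && partial_edge_distinguishing (apply_move c m).

(* A play (or history) is the chronological sequence of all moves made so far
   by both players. *)
Definition play (G : sgraph) := seq (G * 'I_(lambda G)).

Definition position_after G (p : play G) : position G :=
  foldl (@apply_move G) (start G) p.

Definition legal_play G (p : play G) : Prop :=
  forall (q : play G) (m : move G),
    prefix (rcons q m) p -> legal (position_after q) m.

Definition complete_play G (p : play G) : Prop :=
  legal_play p /\ forall m : move G, ~~ legal (position_after p) m.

Definition turn G (p : play G) : player :=
  if odd (size p) then Player2 else Player1.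

Definition last_mover G (p : play G) : option player :=
  if size p is i.+1 then Some (if odd i then Player2 else Player1) else None.

Definition strategy (G : sgraph) := play G -> move G.

Definition follows G (P : player) (s : strategy G) (p : play G) : Prop :=
  forall (q : play G) (m : move G),
    prefix (rcons q m) p -> turn q = P -> m = s q.

(* The first clause is needed: a strategy proposing illegal moves may admit no
   complete play following it, and would then win vacuously. *)
Definition winning_strategy G (P : player) (s : strategy G) : Prop :=
  forall p : play G, legal_play p -> follows P s p ->
    (turn p = P -> (exists m, legal (position_after p) m) ->
       legal (position_after p) (s p)) /\
    (complete_play p -> last_mover p = Some P).

Definition has_winning_strategy (G : sgraph) (P : player) : Prop :=
  exists s : strategy G, winning_strategy P s.

(* Main.v *)
Require Import Defs.
From mathcomp Require Import all_boot.

(** Player 2 answers the opening move by giving a suitable second vertex the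
    same color.  A common neighbor of two equally colored vertices can never be
    colored, which fixes the set of vertices colored at the end, hence the
    parity of the length of the game:
    - if the opening is on a spine, the answer is the other spine, and all pages
      are blocked: two moves;
    - if it is on a page and the number of pages is even, the answer is another
      page, and both spines are blocked while every page gets colored;
    - if it is on a page and the number of pages is odd, the answer is a spine,
      and only the other spine is blocked. *)

Set Implicit Arguments.
Unset Strict Implicit.
Unset Printing Implicit Defensive.

(** * Basic facts on [lambda] and on edges *)

Lemma lambda_gt0 (G : sgraph) : 0 < lambda G.
Proof. by rewrite /lambda; case: ex_minnP => k /andP[]. Qed.

Lemma lambda_edge_distinguishing (G : sgraph) :
  exists c : G -> 'I_(lambda G), edge_distinguishing c.
Proof.
by rewrite /lambda; case: ex_minnP => k /andP[_ /existsP[c c_ed]] _; exists c.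
Qed.

Lemma adj_neq (G : sgraph) (x y : G) : adj x y -> x != y.
Proof. by apply: contraTneq => ->; rewrite adj_irrefl. Qed.

Lemma edgesP (G : sgraph) (e : {set G}) :
  reflect (exists x y, adj x y /\ e = [set x; y]) (e \in edges G).
Proof.
rewrite inE; apply: (iffP existsP) => [[x /existsP[y /andP[xy /eqP->]]]|].
  by exists x, y.
by move=> [x [y [xy ->]]]; exists x; apply/existsP; exists y; rewrite xy /=.
Qed.

Lemma edge_pair (G : sgraph) (x y : G) : adj x y -> [set x; y] \in edges G.
Proof. by move=> xy; apply/edgesP; exists x, y. Qed.

Lemma card_pair_count (T : finType) (P : pred T) (x y : T) :
  x != y -> #|[set z in [set x; y] | P z]| = P x + P y.
Proof.
move=> xy; rewrite -sum1dep_card big_mkcondr /= big_setU1 ?inE //= big_set1.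
by case: (P x); case: (P y).
Qed.

Lemma set2_injr (T : finType) (x y z : T) :
  [set x; y] = [set x; z] -> x != y -> y = z.
Proof.
move=> e xy; have: y \in [set x; z] by rewrite -e !inE eqxx orbT.
by rewrite !inE eq_sym (negPf xy) => /eqP.
Qed.

Lemma edge_distinguishing_cherry (G : sgraph) k (c : G -> 'I_k) x y z :
  edge_distinguishing c -> adj x y -> adj x z -> c y = c z -> y = z.
Proof.
move=> /dinjectiveP c_ed xy xz cyz.
apply: (@set2_injr _ x); last exact: adj_neq.
apply: c_ed; rewrite ?edge_pair //; apply/ffunP=> a.
by rewrite !ffunE !card_pair_count ?adj_neq // cyz.
Qed.

(** * Partial colorings: the blocking rule and criteria for legality *)

Section PartialColorings.

Variables (G : sgraph) (k : nat).
Implicit Types c : partial_coloring G k.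

Lemma partial_edge_colorE c x y : adj x y ->
  partial_edge_color c [set x; y] =
    [ffun a => (c x == Some a) + (c y == Some a)].
Proof.
by move=> xy; apply/ffunP=> a; rewrite !ffunE card_pair_count ?adj_neq.
Qed.

(** Two edges at [x] whose other ends agree in color have the same multiset. Contrapositively, a
    common neighbor of two distinct equally colored vertices stays uncolored. *)
Lemma partial_cherry c x y z : partial_edge_distinguishing c ->
  adj x y -> adj x z -> x \in colored c -> y \in colored c -> c y = c z ->
  y = z.
Proof.
move=> /dinjectiveP c_ed xy xz cx cy cyz.
have cz : z \in colored c by move: cy; rewrite !inE cyz.
apply: (@set2_injr _ x); last exact: adj_neq.
apply: c_ed; last by rewrite !partial_edge_colorE // cyz.
  by rewrite inE edge_pair //= subUset !sub1set cx.
by rewrite inE edge_pair //= subUset !sub1set cx.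
Qed.

(** Two vertices span at most one edge. This makes the opening and the reply legal. *)
Lemma partial_edge_distinguishing_small c :
  #|colored c| <= 2 -> partial_edge_distinguishing c.
Proof.
move=> c_le2; apply/dinjectiveP.
suff ind_eq e : e \in induced_edges (colored c) -> e = colored c.
  by move=> e f /ind_eq-> /ind_eq->.
rewrite inE => /andP[/edgesP[x [y [xy ->]]] sub].
by apply/eqP; rewrite eqEcard sub cards2 adj_neq.
Qed.

Lemma partial_edge_distinguishing_stable c :
  {in colored c &, forall x y, ~~ adj x y} -> partial_edge_distinguishing c.
Proof.
move=> stable; apply/dinjectiveP=> e f; rewrite inE.
case/andP=> /edgesP[x [y [xy ->]]]; rewrite subUset !sub1set => /andP[cx cy].
by have := stable _ _ cx cy; rewrite xy.
Qed.

(** Each induced edge is determined by its end other than [s], and the color of that end is what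
    remains of the multiset once the color of [s] is removed. *)
Lemma partial_edge_distinguishing_star c s :
  {in colored c &, forall x y, adj x y -> (x == s) || (y == s)} ->
  {in colored c &, forall x y, x != s -> y != s -> c x = c y -> x = y} ->
  partial_edge_distinguishing c.
Proof.
move=> star c_inj; apply/dinjectiveP.
have starE e : e \in induced_edges (colored c) ->
    exists x, [/\ x \in colored c, adj s x & e = [set s; x]].
  rewrite inE => /andP[/edgesP[x [y [xy ->]]]].
  rewrite subUset !sub1set => /andP[cx cy].
  case/orP: (star _ _ cx cy xy) => /eqP eqs; subst s; first by exists y.
  by exists x; rewrite adj_sym setUC.
move=> e f /starE[x [cx sx ->]] /starE[y [cy sy ->]].
rewrite !partial_edge_colorE // => /ffunP eqc.
suff -> : x = y by [].
apply: c_inj => //; rewrite 1?eq_sym ?adj_neq //.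
move: cx; rewrite inE; case cxE: (c x) => [a|//] _.
(* At the color [a] of [x], cancelling the contribution of [s] leaves multiplicity 1 on the side of
   [x], which forces [y] to have color [a]. *)
by have := eqc a; rewrite !ffunE cxE eqxx => /addnI; case: eqP.
Qed.

End PartialColorings.

(** * Plays and the copying strategy *)

Section Plays.

Variable G : sgraph.
Implicit Types (p : play G) (m : move G) (c : position G).

Lemma position_after_rcons p m :
  position_after (rcons p m) = apply_move (position_after p) m.
Proof. exact: foldl_rcons. Qed.

Lemma colored_start : colored (start G) = set0.
Proof. by apply/setP=> x; rewrite !inE ffunE. Qed.

Lemma colored_apply_move c m : colored (apply_move c m) = m.1 |: colored c.
Proof. by apply/setP=> x; rewrite !inE ffunE; case: ifP. Qed.

Lemma legal_play_rcons p m :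
  legal_play (rcons p m) -> legal_play p /\ legal (position_after p) m.
Proof.
move=> lp; split; last exact/lp/prefix_refl.
by move=> q m' pq; apply: lp; apply: prefix_trans pq (prefix_rcons _ _).
Qed.

(** A legal move colors exactly one new vertex; the winner can thus be read off the parity of the
    final colored set. *)
Lemma card_colored_play p :
  legal_play p -> #|colored (position_after p)| = size p.
Proof.
elim/last_ind: p => [|p m IHp]; first by rewrite colored_start cards0.
case/legal_play_rcons=> /IHp IH /andP[new _].
by rewrite position_after_rcons colored_apply_move cardsU1 new IH size_rcons.
Qed.

Lemma position_after_mem p m :
  legal_play p -> m \in p -> position_after p m.1 = Some m.2.
Proof.
elim/last_ind: p => [|p m' IHp] // /legal_play_rcons[/IHp IH /andP[new _]].
rewrite mem_rcons inE position_after_rcons ffunE.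
case/predU1P=> [->|/IH pm]; first by rewrite eqxx.
by case: eqP new => [<-|//]; rewrite inE pm.
Qed.

Lemma partial_edge_distinguishing_play p :
  legal_play p -> partial_edge_distinguishing (position_after p).
Proof.
elim/last_ind: p => [|p m _].
  by rewrite partial_edge_distinguishing_small // colored_start cards0.
by case/legal_play_rcons=> _ /andP[_]; rewrite position_after_rcons.
Qed.

(* Player 2 answers the opening at [x] on [y], with the same color, and then
   plays arbitrary legal moves. *)
Lemma copying_wins (x0 : G) :
  (forall x : G, exists2 y, y != x & forall c,
    partial_edge_distinguishing c -> (forall m, ~~ legal c m) ->
    x \in colored c -> c x = c y -> ~~ odd #|colored c|) ->
  has_winning_strategy G Player2.
Proof.
move=> copy.
have /fin_all_exists2[r r_neq r_even] := copy.
(* [m0] is the default of [any] when no legal move is left; it also serves below as a legal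
   opening. *)
pose m0 : move G := (x0, Ordinal (lambda_gt0 G)).
pose any p : move G := odflt m0 [pick m | legal (position_after p) m].
pose s p := if p is [:: m] then (r m.1, m.2) else any p.
have legal_any p : (exists m, legal (position_after p) m) ->
    legal (position_after p) (any p).
  by move=> [m lm]; rewrite /any; case: pickP => [//|/(_ m)]; rewrite lm.
have legal_reply m : legal (position_after [:: m]) (r m.1, m.2).
  rewrite /legal /position_after /= colored_apply_move colored_start setU0.
  rewrite inE r_neq /=; apply: partial_edge_distinguishing_small.
  by rewrite !colored_apply_move colored_start setU0 cards2 r_neq.
exists s => p lp fp; split=> [_ ex|[_ stuck]].
  by case: p {lp fp} ex => [|m [|m' p]] ex; rewrite ?legal_reply // legal_any.
suff : 0 < size p /\ ~~ odd (size p).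
  rewrite /last_mover; case: (size p) => [[]//|i].
  by rewrite oddS negbK => -[_ ->].
(* Plays of length 0 or 1 are not complete: the opening [m0], respectively the reply, is still
   legal. *)
case: p lp fp stuck => [|m [|m' p]] lp fp stuck.
- have /negP[] := stuck m0; rewrite /legal colored_start inE /=.
  apply: partial_edge_distinguishing_small.
  by rewrite colored_apply_move colored_start setU0 cards1.
- by have /negP[] := stuck (r m.1, m.2); apply: legal_reply.
have m'E : m' = (r m.1, m.2).
  by apply: (fp [:: m]) => //; rewrite /= !eqxx prefix0s.
split=> //; rewrite -(card_colored_play lp).
have pm : position_after [:: m, m' & p] m.1 = Some m.2.
  by apply: position_after_mem => //; rewrite mem_head.
have pm' : position_after [:: m, m' & p] (r m.1) = Some m.2.
  have := @position_after_mem [:: m, m' & p] m' lp.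
  by rewrite m'E; apply; rewrite !inE eqxx orbT.
apply: (r_even m.1) => //; first exact: partial_edge_distinguishing_play.
  by rewrite inE pm.
by rewrite pm pm'.
Qed.

End Plays.

(** * The book graph: parity of the colored set after each reply *)

Section Book.

Variable n : nat.
Local Notation G := (book n).
Implicit Types (c : position G) (s : 'I_2) (w : 'I_(n - 2)).

Definition spine s : G := inl s.
Definition page w : G := inr w.

Lemma spine_page s w : adj (spine s) (page w). Proof. by []. Qed.

Lemma page_spine w s : adj (page w) (spine s). Proof. by []. Qed.

Lemma page_page w w' : adj (page w) (page w') = false.
Proof. by rewrite /= /compl_adj /= /complete_adj andbN. Qed.

Lemma page_inj : injective page. Proof. by move=> w w' []. Qed.

(** All pages are neighbors of one spine, so an edge-distinguishing coloring gives them distinct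
    colors. *)
Lemma page_le_lambda : n - 2 <= lambda G.
Proof.
have [c c_ed] := lambda_edge_distinguishing G.
rewrite -[n - 2]card_ord -[lambda G]card_ord.
apply: (@leq_card _ _ (c \o page)) => w w' /= cw.
exact/page_inj/(edge_distinguishing_cherry c_ed (spine_page ord0 w)).
Qed.

Definition pages : {set G} := [set page w | w in 'I_(n - 2)].

Lemma card_pages : #|pages| = n - 2.
Proof. by rewrite card_imset ?card_ord //; apply: page_inj. Qed.

Lemma spine_notin_pages s : spine s \notin pages.
Proof. by apply/imsetP=> [[]]. Qed.

Lemma mem_pages w : page w \in pages.
Proof. exact: imset_f. Qed.

(** On ['I_2], [rev_ord] exchanges the two elements, so it names the other spine. *)
Lemma rev_spine s : adj (spine (rev_ord s)) (spine s).
Proof. by case: s => [[|[|]]]. Qed.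

Lemma spine_or_rev s (t : 'I_2) : t != s -> t = rev_ord s.
Proof. by move: s t => [[|[|//]] ?] [[|[|//]] ?] // _; apply/val_inj. Qed.

Lemma even_of_equal_spines c s :
  partial_edge_distinguishing c ->
  spine s \in colored c -> c (spine s) = c (spine (rev_ord s)) ->
  ~~ odd #|colored c|.
Proof.
move=> c_ed cs eq_c.
suff -> : colored c = [set spine s; spine (rev_ord s)].
  by rewrite cards2 eq_sym (adj_neq (rev_spine s)).
apply/setP=> -[t|w]; last first.
  apply/idP/idP=> [cw|]; last by rewrite !inE.
  have /eqP := partial_cherry c_ed (page_spine w s) (page_spine w _) cw cs eq_c.
  by rewrite eq_sym (negPf (adj_neq (rev_spine s))).
rewrite in_set2; have [->|ts] := eqVneq t s; first by rewrite cs eqxx.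
by rewrite (spine_or_rev ts) eqxx orbT inE -eq_c; move: cs; rewrite inE.
Qed.

(** Both spines are blocked, and pages are pairwise nonadjacent, so the game stops only when all
    pages are colored. *)
Lemma even_of_equal_pages c w w' : ~~ odd (n - 2) -> w' != w ->
  partial_edge_distinguishing c -> (forall m, ~~ legal c m) ->
  page w \in colored c -> c (page w) = c (page w') -> ~~ odd #|colored c|.
Proof.
move=> n_even ww' c_ed stuck cw eq_c.
have nospine s : spine s \notin colored c.
  apply: contraNN ww' => cs; apply/eqP/esym/page_inj.
  exact: (partial_cherry c_ed (spine_page s w) (spine_page s w')).
suff -> : colored c = pages by rewrite card_pages.
apply/setP=> -[s|v].
  by rewrite (negPf (nospine s)) (negPf (spine_notin_pages s)).
rewrite mem_pages; apply/negPn/negP=> cv.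
have /negP[] := stuck (page v, Ordinal (lambda_gt0 G)).
rewrite /legal cv; apply: partial_edge_distinguishing_stable.
rewrite colored_apply_move => -[s|x] [t|y];
  rewrite !inE ?page_page //; have := nospine; rewrite /spine.
- by move=> /(_ s); rewrite inE /= => /negPf->.
- by move=> /(_ s); rewrite inE /= => /negPf->.
- by move=> /(_ t); rewrite inE /= => /negPf->.
Qed.

(** The other spine is blocked, being adjacent to both [page w] and [spine s]. An uncolored page
    always has a free color, so the final count is one spine plus all pages. *)
Lemma even_of_equal_page_spine c w s : odd (n - 2) ->
  partial_edge_distinguishing c -> (forall m, ~~ legal c m) ->
  page w \in colored c -> c (page w) = c (spine s) -> ~~ odd #|colored c|.
Proof.
move=> n_odd c_ed stuck cw eq_c.
have cs : spine s \in colored c by move: cw; rewrite !inE eq_c.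
have nospine : spine (rev_ord s) \notin colored c.
  apply/negP=> cv.
  by have := partial_cherry c_ed (spine_page _ w) (rev_spine s) cv cw eq_c.
have page_c_inj w1 w2 : page w1 \in colored c -> c (page w1) = c (page w2) ->
    page w1 = page w2.
  by move=> c1; apply: (partial_cherry c_ed (spine_page s w1)).
suff -> : colored c = spine s |: pages.
  by rewrite cardsU1 spine_notin_pages card_pages /= n_odd.
apply/setP=> -[t|v]; rewrite in_setU1.
  rewrite (negPf (spine_notin_pages t)) orbF.
  have [->|ts] := eqVneq t s; first by rewrite cs eqxx.
  rewrite (spine_or_rev ts) (negPf nospine); apply/esym/negbTE.
  exact: adj_neq (rev_spine s).
rewrite mem_pages orbT; apply/negPn/negP=> cv.
(* Pigeonhole: if every color occurred on a page, choosing one such page per color would inject the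
   colors into the pages other than [v], against [page_le_lambda]. *)
have /existsP[a /forallP a_free] : [exists a, forall x, c (page x) != Some a].
  apply: contraT => /existsPn all_used.
  have /fin_all_exists[f fP] a : exists x, c (page x) = Some a.
    by have /forallPn[x /negPn/eqP] := all_used a; exists x.
  have f_inj : injective f.
    by move=> a b eq_f; have := fP a; rewrite eq_f fP => -[].
  have : #|f @: 'I_(lambda G)| <= #|[set~ v]|.
    apply/subset_leq_card/subsetP=> _ /imsetP[b _ ->]; rewrite !inE.
    by apply: contraNneq cv => <-; rewrite inE fP.
  rewrite card_imset // cardsC1 !card_ord => /(leq_trans page_le_lambda).
  (* The existence of [v] makes [n - 2] positive, so its predecessor is strictly smaller. *)
  by rewrite leqNgt ltn_predL (leq_ltn_trans (leq0n v)).
pose c' := apply_move c (page v, a).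
(* After the move, [spine s] is the only colored vertex that is not a page, hence the center of a
   star. *)
have pageP z : z \in colored c' -> z != spine s -> exists w', z = page w'.
  rewrite colored_apply_move in_setU1.
  case: z => [t|w'] ct ts; last by exists w'.
  have {}ts : t != s by apply: contraNneq ts => ->.
  by move: ct; rewrite (spine_or_rev ts) /= (negPf nospine).
have /negP[] := stuck (page v, a).
rewrite /legal cv; apply: (@partial_edge_distinguishing_star _ _ _ (spine s)).
  move=> x y cx cy; apply: contraTT; rewrite negb_or.
  by case/andP=> /(pageP _ cx)[x' ->] /(pageP _ cy)[y' ->]; rewrite page_page.
move=> x y cx cy /(pageP _ cx)[x' xE] /(pageP _ cy)[y' yE]; subst x y.
move: cx cy; rewrite colored_apply_move !in_setU1 !ffunE /=.
case: eqP => [->|_] /= cx; case: eqP => [->|_] /= cy //.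
- by move/esym/eqP; rewrite (negPf (a_free _)).
- by move/eqP; rewrite (negPf (a_free _)).
exact: page_c_inj.
Qed.

End Book.

Theorem theorem3p7 (n : nat) (n_ge3 : 3 <= n) :
  has_winning_strategy (book n) Player2.
Proof.
have n_gt2 : 0 < n - 2 by rewrite subn_gt0.
apply: (copying_wins (spine n ord0)) => -[s|w].
  exists (spine n (rev_ord s)); first exact: adj_neq (rev_spine n s).
  by move=> c c_ed _; apply: even_of_equal_spines.
have [n_odd|n_even] := boolP (odd (n - 2)).
  by exists (spine n ord0) => // c; apply: even_of_equal_page_spine.
(* A positive even number of pages is at least 2, so another page exists. *)
have /card_gt0P[w'] : 0 < #|[set~ w]|.
  by rewrite cardsC1 card_ord; case: (n - 2) n_even n_gt2 => [|[|]].
rewrite !inE => ww'; exists (page w'); first by rewrite (inj_eq (@page_inj n)).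
by move=> c; apply: even_of_equal_pages.
Qed.
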